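(* Let $P$ be a poset. Then the following statements are equivalent: (1) $(P,\sigma(P))$ is core-compact. (2) $(\Gamma(P),\sigma(\Gamma(P)))$ is core-compact. (3) $(\Gamma(P),\sigma(\Gamma(P)))$ is sober and locally compact. (4) $(\Gamma(P),\sigma(\Gamma(P)))$ is sober and locally compact, and $\sigma(\Gamma(P))=\upsilon(\Gamma(P))$.
   Context: For a poset $P$, a subset $A\subseteq P$ is Scott closed if it is a lower set and for every directed $D\subseteq A$ whose supremum $\bigvee D$ exists in $P$ one has $\bigvee D\in A$. The Scott topology $\sigma(P)$ consists of the complements of Scott closed sets. $\Gamma(P)$ is the complete lattice of all Scott closed subsets of $P$ (including $\emptyset$), ordered by inclusion, and $\sigma(\Gamma(P))$ is the Scott topology of this poset. The lower Vietoris topology $\upsilon(\Gamma(P))$ on $\Gamma(P)$ is generated by the subbase of sets $\Diamond U=\{A\in\Gamma(P): A\cap U\neq\emptyset\}$, $U\in\sigma(P)$ (equivalently, it is the upper topology of the lattice $\Gamma(P)$, with subbase $\{\Gamma(P)\setminus\{B: B\subseteq A\}: A\in\Gamma(P)\}$). A topological space is core-compact if its lattice of open sets, ordered by inclusion, is a continuous lattice. A space is locally compact if for every point $x$ and open $U\ni x$ there is a compact set $K$ with $x\in\mathrm{int}\,K\subseteq K\subseteq U$. A space is sober if every irreducible closed set is the closure of a unique point. *)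

(* Defs.v *)
From HB Require Import structures.
From mathcomp Require Import all_boot all_order.
From mathcomp Require Import boolp classical_sets filter topology.

Set Implicit Arguments.
Unset Strict Implicit.
Unset Printing Implicit Defensive.

Import Order.TTheory.
Local Open Scope classical_set_scope.
Local Open Scope order_scope.

Section Posets.
Context {d : Order.disp_t} {P : porderType d}.
Implicit Types (A D : set P) (x y s : P).

Definition directed D :=
  D !=set0 /\ forall x y, D x -> D y -> exists z, [/\ D z, x <= z & y <= z].

Definition lower_set A := forall x y, x <= y -> A y -> A x.

(* [supremums D s] says that the supremum of [D] exists and equals [s]. *)
Definition scott_closed A :=
  lower_set A /\
  forall D, directed D -> D `<=` A -> forall s, supremums D s -> A s.

Definition way_below x y :=
  forall D s, directed D -> supremums D s -> y <= s ->
    exists2 z, D z & x <= z.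

End Posets.

Definition complete_lattice d (L : porderType d) :=
  forall A : set L, supremums A !=set0.

Definition continuous_lattice d (L : porderType d) :=
  complete_lattice L /\
  forall x : L, directed [set y | way_below y x] /\
                supremums [set y | way_below y x] x.

Definition scott (T : Type) : Type := T.

Section ScottTopology.
Context {d : Order.disp_t} {P : porderType d}.

Definition scott_open (U : set P) := scott_closed (~` U).

Lemma scott_openT : scott_open setT.
Proof.
rewrite /scott_open setCT; split=> [x y _ []|D [[x Dx] _] /(_ x Dx) []].
Qed.

Lemma scott_openI : setI_closed scott_open.
Proof.
move=> U V [lU dU] [lV dV]; split=> [x y xy nUV [Ux Vx]|D dD DUV s sD [Us Vs]].
  apply: nUV; split; apply: contrapT => h.
    exact: (lU _ _ xy h).
  exact: (lV _ _ xy h).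
have [a Da Ua] : exists2 a, D a & U a.
  apply: contrapT => h; apply: (dU D dD _ s sD Us) => a Da Ua.
  by apply: h; exists a.
have [b Db Vb] : exists2 b, D b & V b.
  apply: contrapT => h; apply: (dV D dD _ s sD Vs) => b Db Vb.
  by apply: h; exists b.
have [c [Dc ac bc]] := dD.2 a b Da Db.
apply: (DUV c Dc); split; apply: contrapT.
  by move=> /(lU _ _ ac); apply.
by move=> /(lV _ _ bc); apply.
Qed.

Lemma scott_open_bigU (I : Type) (f : I -> set P) :
  (forall i, scott_open (f i)) -> scott_open (\bigcup_i f i).
Proof.
move=> of_; split=> [x y xy nfy [i _ fix_]|D dD Df s sD [i _ fis]].
  by case: (of_ i) => l _; apply: (l x y xy) fix_ => fiy; apply: nfy; exists i.
case: (of_ i) => _ h; apply: (h D dD _ s sD fis) => a Da fia.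
by apply: (Df a Da); exists i.
Qed.

HB.instance Definition _ := Order.POrder.on (scott P).
HB.instance Definition _ := @isOpenTopological.Build (scott P)
  scott_open scott_openT scott_openI scott_open_bigU.

End ScottTopology.

Definition open_sets (T : topologicalType) : set (set T) := open.
Arguments open_sets T : clear implicits.

Section Hyperspace.
Context {d : Order.disp_t}.

Definition Gamma (P : porderType d) : Type := [set A : set P | scott_closed A].

(* The order on [set P] is inclusion. *)
HB.instance Definition _ P := SubChoice.on (Gamma P).
HB.instance Definition _ P :=
  [SubChoice_isSubPOrder of Gamma P by <: with set_display].

Definition diamond (P : porderType d) (U : set P) : set (Gamma P) :=
  [set A | val A `&` U !=set0].

Definition lower_vietoris (P : porderType d) : Type := Gamma P.

HB.instance Definition _ P := Choice.on (lower_vietoris P).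
HB.instance Definition _ P := @isSubBaseTopological.Build (lower_vietoris P)
  (set P) (open_sets (scott P)) (@diamond P).

End Hyperspace.

Definition opens (T : topologicalType) : Type := open_sets T.

HB.instance Definition _ T := SubChoice.on (opens T).
HB.instance Definition _ T :=
  [SubChoice_isSubPOrder of opens T by <: with set_display].

Definition core_compact (T : topologicalType) := continuous_lattice (opens T).

(* The library's [locally_compact] asks for a single precompact neighbourhood
   of each point, which is not equivalent for non-Hausdorff spaces. *)
Definition locally_compact_space (T : topologicalType) :=
  forall (x : T) (U : set T), open U -> U x ->
    exists K : set T, [/\ compact K, K° x & K `<=` U].

Definition irreducible_closed (T : topologicalType) (C : set T) :=
  [/\ closed C, C !=set0 &
      forall A B : set T, closed A -> closed B -> C `<=` A `|` B ->
        C `<=` A \/ C `<=` B].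

Definition sober (T : topologicalType) :=
  forall C : set T, irreducible_closed C -> exists! x, C = closure [set x].

(* Main.v *)
Require Import Defs.
From mathcomp Require Import all_boot all_order finmap.
From mathcomp Require Import boolp classical_sets filter topology.

(** Write V << U for the way-below relation between open sets, so that a space
    is core-compact when each open U is the union of the open V << U.

    Suppose that P is core-compact.  The heart of the matter is that every
    Scott open family UU of closed sets is open for the lower Vietoris topology
    ([scott_open_diamonds_base]).  A closed set A in UU is the directed
    supremum of its finitely generated lower subsets, so UU already contains
    the down-closure of some x1, ..., xn in A, and it is enough to find open
    Ui containing xi such that every closed set meeting all the Ui lies in UU.
    The xi are treated one at a time: the condition that UU contains the union
    of the down-closure of p with B is Scott open in p and in B separately, and
    core-compactness of the first factor makes such a condition open for the
    product topology ([separately_open_box]).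

    With finite intersections of diamonds as a base, sobriety and local
    compactness of the hyperspace become lattice arguments.  An irreducible
    closed family contains the closure of its union, because every basic
    neighbourhood of that closure meets the family; it is thus the closure of
    this point ([scott_Gamma_sober]).  For local compactness, if V << U then
    the family of the closed sets that meet every W with V << W lies between
    diamond V and diamond U, and interpolation of << makes it compact
    ([compact_diamonds]).

    Conversely, a locally compact space is core-compact
    ([locally_compact_core_compact]), and core-compactness descends from the
    hyperspace to P because the open sets of P are a retract of those of the
    hyperspace: U is recovered from diamond U by pulling back along the map
    sending x to its down-closure, and both diamond and the pullback preserve
    unions ([Gamma_core_compact_inv]). *)
Set Implicit Arguments.
Unset Strict Implicit.
Unset Printing Implicit Defensive.

Import Order.TTheory.
Local Open Scope order_scope.
Local Open Scope classical_set_scope.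

(** * The way-below relation on open sets *)

Lemma directed_setU_closed (T : Type) (D : set (set T)) :
  D set0 -> setU_closed D -> directed D.
Proof.
move=> D0 DU; split=> [|U V DUU DV]; first by exists set0.
exists (U `|` V); rewrite !subsetEset.
by split; [exact: DU|exact: subsetUl|exact: subsetUr].
Qed.

Section WayBelowOpens.
Context {T : topologicalType}.
Implicit Types (U V W O : set T) (D : set (set T)).

(** The way-below relation of the lattice of open sets, phrased for arbitrary
    sets so that it also applies to a compact set inside an open one. *)
Definition compactly_in V U :=
  forall D, D `<=` open -> directed D -> U `<=` \bigcup_(O in D) O ->
    exists2 O, D O & V `<=` O.

Lemma compactly_in_subset V U : open U -> compactly_in V U -> V `<=` U.
Proof.
move=> oU /(_ [set U]) [|||O -> //]; first by move=> _ ->.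
  by split=> [|_ _ -> ->]; exists U.
by move=> x Ux; exists U.
Qed.

Lemma compactly_inS V' V U U' :
  V' `<=` V -> U `<=` U' -> compactly_in V U -> compactly_in V' U'.
Proof.
move=> sV sU cVU D oD dD U'D; have [|O DO VO] := cVU D oD dD.
  exact: subset_trans U'D.
by exists O => //; exact: subset_trans VO.
Qed.

Lemma compactly_in0 U : compactly_in set0 U.
Proof. by move=> D _ [[O DO] _] _; exists O. Qed.

Lemma compactly_inU V W U :
  compactly_in V U -> compactly_in W U -> compactly_in (V `|` W) U.
Proof.
move=> cV cW D oD dD UD; have [O DO VO] := cV D oD dD UD.
have [Q DQ WQ] := cW D oD dD UD; have [R [DR OR QR]] := dD.2 O Q DO DQ.
rewrite !subsetEset in OR QR.
by exists R => // x [/VO/OR|/WQ/QR].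
Qed.

Lemma directed_compactly_in U :
  directed [set V | open V /\ compactly_in V U].
Proof.
apply: directed_setU_closed; first by split; [exact: open0|exact: compactly_in0].
by move=> V W [oV cV] [oW cW]; split; [exact: openU|exact: compactly_inU].
Qed.

Definition to_opens U (oU : open U) : opens T :=
  exist (fun V => V \in open_sets T) U (mem_set oU).

Lemma open_val (U : opens T) : open (val U).
Proof. exact: (set_mem (valP U)). Qed.

Lemma le_opens (U V : opens T) : (U <= V) = (val U `<=` val V) :> Prop.
Proof. by rewrite -subsetEset. Qed.

Lemma supremums_opens (D : set (opens T)) (s : opens T) :
  supremums D s <-> val s = \bigcup_(O in D) val O.
Proof.
have oU : open (\bigcup_(O in D) val O).
  by apply: bigcup_open => O _; exact: (open_val O).
pose u := to_opens oU.
have uD : ubound D u.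
  by move=> O DO; rewrite le_opens => x Ox; exists O.
split=> [[sub slub]|sE].
  rewrite eqEsubset; split; first by have := slub u uD; rewrite le_opens.
  by move=> x [O DO Ox]; have := sub O DO; rewrite le_opens; exact.
split=> [O DO|t tD]; rewrite le_opens sE; first by move=> x Ox; exists O.
by move=> x [O DO Ox]; have := tD O DO; rewrite le_opens; exact.
Qed.

Lemma way_below_opens (V U : opens T) :
  way_below V U <-> compactly_in (val V) (val U).
Proof.
split=> [wVU D oD [D0 dD] UD|cVU D s [D0 dD] /supremums_opens sE].
  pose D' : set (opens T) := [set O | D (val O)].
  have D'_val O : D O -> exists2 O' : opens T, D' O' & val O' = O.
    by move=> DO; exists (to_opens (oD O DO)).
  have bigE : \bigcup_(O in D') val O = \bigcup_(O in D) O.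
    rewrite eqEsubset; split=> [x [O DO Ox]|x [O DO Ox]]; first by exists (val O).
    by have [O' DO' O'E] := D'_val O DO; exists O' => //; rewrite O'E.
  have oU : open (\bigcup_(O in D) O) by apply: bigcup_open.
  have [|||O D'O VO] := wVU D' (to_opens oU).
  - split=> [|O Q DO DQ].
      by have [O DO] := D0; have [O' ? _] := D'_val O DO; exists O'.
    have [R [DR OR QR]] := dD _ _ DO DQ; have [R' DR' R'E] := D'_val R DR.
    by exists R'; rewrite !le_opens -!subsetEset R'E.
  - by apply/supremums_opens; rewrite bigE.
  - by rewrite le_opens.
  by exists (val O) => //; rewrite -le_opens.
rewrite le_opens sE => Us.
have [|||_ [O DO <-] VO] := cVU (val @` D).
- by move=> _ [O _ <-]; exact: (open_val O).
- split=> [|_ _ [O DO <-] [Q DQ <-]].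
    by have [O DO] := D0; exists (val O); exists O.
  have [R [DR OR QR]] := dD O Q DO DQ.
  by exists (val R); split; first by exists R.
- by move=> x /Us [O DO Ox]; exists (val O) => //; exists O.
by exists O => //; rewrite le_opens.
Qed.

Lemma core_compactP : core_compact T <->
  forall U x, open U -> U x -> exists V, [/\ open V, V x & compactly_in V U].
Proof.
split=> [[_ ccT] U x oU Ux|ccT].
  have [_ /supremums_opens UE] := ccT (to_opens oU).
  move: Ux; rewrite [X in X x]UE => -[V /way_below_opens VU Vx].
  by exists (val V); split=> //; exact: (open_val V).
split=> [D|U].
  have oU : open (\bigcup_(O in D) val O).
    by apply: bigcup_open => O _; exact: (open_val O).
  by exists (to_opens oU); apply/supremums_opens.
split.
  have [[V0 V0p] dU] := directed_compactly_in (val U).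
  split=> [|V W /way_below_opens VU /way_below_opens WU].
    by exists (to_opens V0p.1); apply/way_below_opens; exact: V0p.2.
  have [||Z [[oZ ZU] VZ WZ]] := dU (val V) (val W).
  - by split=> //; exact: (open_val V).
  - by split=> //; exact: (open_val W).
  exists (to_opens oZ).
  by split; [apply/way_below_opens| |].
apply/supremums_opens; rewrite eqEsubset; split=> [x Ux|x [V /way_below_opens VU]].
  have [V [oV Vx VU]] := ccT (val U) x (open_val U) Ux.
  by exists (to_opens oV) => //; apply/way_below_opens.
exact: (compactly_in_subset (open_val U) VU).
Qed.

(** Core-compactness used twice shows that the open O with O << W << U for some
    W cover U; they form a directed family, so one of them contains V. *)
Lemma compactly_in_interpolate V U : core_compact T -> open U ->
  compactly_in V U ->
  exists W, [/\ open W, compactly_in V W & compactly_in W U].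
Proof.
move=> /core_compactP ccT oU cVU.
pose D := [set O | open O /\
  exists W, [/\ open W, compactly_in O W & compactly_in W U]].
have [|||O [oO [W [oW OW WU]]] VO] := cVU D.
- by move=> O [].
- apply: directed_setU_closed.
    split; first exact: open0.
    by exists set0; split; [exact: open0|exact: compactly_in0|exact: compactly_in0].
  move=> O Q [oO [W [oW OW WU]]] [oQ [Z [oZ QZ ZU]]]; split; first exact: openU.
  exists (W `|` Z); split; [exact: openU| |exact: compactly_inU].
  by apply: compactly_inU;
    [apply: compactly_inS OW => // x; left|apply: compactly_inS QZ => // x; right].
- move=> x Ux; have [W [oW Wx WU]] := ccT U x oU Ux.
  have [O [oO Ox OW]] := ccT W x oW Wx.
  by exists O => //; split=> //; exists W.
by exists W; split=> //; exact: compactly_inS OW.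
Qed.

(** If no member of a directed open cover contained K, the complements in K of
    the members would generate a proper filter with no cluster point in K. *)
Lemma compact_compactly_in K U : compact K -> K `<=` U -> compactly_in K U.
Proof.
move=> cK KU D oD [[O0 DO0] dD] UD.
pose F := [set S | exists2 O, D O & K `\` O `<=` S].
have FF : Filter F.
  split=> [|S S' [O DO OS] [Q DQ QS]|S S' SS' [O DO OS]].
  - by exists O0.
  - have [R [DR OR QR]] := dD O Q DO DQ; rewrite !subsetEset in OR QR.
    exists R => // x [Kx nRx].
    by split; [apply: OS; split=> // /OR|apply: QS; split=> // /QR].
  - by exists O => //; exact: subset_trans SS'.
apply: contrapT => noO.
have PF : ProperFilter F.
  split=> // -[O DO KO]; apply: noO; exists O => // x Kx.
  by apply: contrapT => nOx; exact: (KO x).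
have [|x [Kx clx]] := cK F PF; first by exists O0 => // x [].
have [O DO Ox] := UD x (KU x Kx).
have [||y [[_ nOy] Oy]] := clx (K `\` O) O; last exact: nOy.
  by exists O.
by apply: open_nbhs_nbhs; split=> //; exact: oD.
Qed.

Lemma locally_compact_core_compact :
  locally_compact_space T -> core_compact T.
Proof.
move=> lcT; apply/core_compactP => U x oU Ux.
have [K [cK Kx KU]] := lcT x U oU Ux.
exists K°; split=> //; first exact: open_interior.
apply: compactly_inS (compact_compactly_in cK KU) => //.
exact: interior_subset.
Qed.

End WayBelowOpens.

(** * Scott open sets *)

Section ScottOpens.
Context {d : Order.disp_t} {P : porderType d}.
Implicit Types (U D : set P) (x y s : P).

Lemma scott_openE U : scott_open U <->
  (forall x y, x <= y -> U x -> U y) /\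
  (forall D s, directed D -> supremums D s -> U s -> exists2 x, D x & U x).
Proof.
split=> [[lU dU]|[uU dU]].
  split=> [x y xy Ux|D s dD Ds Us].
    by apply: contrapT => nUy; exact: (lU x y xy nUy).
  apply: contrapT => noD; apply: (dU D dD _ s Ds) => // x Dx Ux.
  by apply: noD; exists x.
split=> [x y xy nUy Ux|D dD Dn s Ds Us]; first exact: nUy (uU x y xy Ux).
by have [x Dx Ux] := dU D s dD Ds Us; exact: (Dn x).
Qed.

Lemma scott_open_upper U x y : scott_open U -> x <= y -> U x -> U y.
Proof. by move=> /scott_openE[uU _]; exact: uU. Qed.

Lemma scott_open_sup U D s :
  scott_open U -> directed D -> supremums D s -> U s -> exists2 x, D x & U x.
Proof. by move=> /scott_openE[_ dU]; exact: dU. Qed.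

Lemma scott_openCE (X : set P) : scott_closed X <-> scott_open (~` X).
Proof. by rewrite /scott_open setCK. Qed.

Lemma scott_closedU (X Y : set P) :
  scott_closed X -> scott_closed Y -> scott_closed (X `|` Y).
Proof.
rewrite !scott_openCE setCU; exact: scott_openI.
Qed.

Lemma scott_closed0 : scott_closed (set0 : set P).
Proof. by rewrite scott_openCE setC0; exact: scott_openT. Qed.

Lemma closed_scottE (X : set P) : closed (X : set (scott P)) = scott_closed X.
Proof. by rewrite -openC -[open _]/(scott_open (~` X)) /scott_open setCK. Qed.

Lemma scott_closed_principal x : scott_closed [set y | y <= x].
Proof.
split=> [y z yz /= zx|D dD Dx s [_]]; first exact: le_trans zx.
by apply => y /Dx.
Qed.

Lemma scott_closure1 (x : scott P) : closure [set x] = [set y | y <= x].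
Proof.
rewrite eqEsubset; split.
  rewrite closureE; apply: smallest_sub; last by move=> _ ->; exact: lexx.
  rewrite -openC.
  change (scott_open (~` [set y : P | y <= x])).
  by rewrite /scott_open setCK; exact: scott_closed_principal.
move=> y yx U; rewrite nbhsE => -[V [oV Vy] VU]; exists x; split=> //.
by apply: VU; apply: (scott_open_upper oV yx).
Qed.

End ScottOpens.

Lemma scott_open_preimage d d' (P : porderType d) (Q : porderType d')
    (f : P -> Q) (U : set Q) :
  {homo f : x y / x <= y} ->
  (forall D s, directed D -> supremums D s -> supremums (f @` D) (f s)) ->
  scott_open U -> scott_open (f @^-1` U).
Proof.
move=> hf sf oU; apply/scott_openE; split=> [x y xy|D s dD Ds Ufs].
  exact: (scott_open_upper oU (hf _ _ xy)).
have [|_ [x Dx <-] Ufx] := scott_open_sup oU _ (sf D s dD Ds) Ufs.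
  split=> [|_ _ [x Dx <-] [y Dy <-]].
    by have [x Dx] := dD.1; exists (f x); exists x.
  have [z [Dz xz yz]] := dD.2 x y Dx Dy.
  by exists (f z); split; [exists z|exact: hf|exact: hf].
by exists x.
Qed.

Section Box.
Context {T : topologicalType} {d : Order.disp_t} {Q : porderType d}.

(** Pick an open U with p0 in U << W(-, q0).  The set V of the q such that
    U << W(-, q) is Scott open: if U << W(-, q), interpolate U << Z << W(-, q);
    for q the supremum of a directed D, the sections over D increase to the
    one over q, so one of them contains Z. *)
Lemma separately_open_box (W : T -> Q -> Prop) p0 q0 : core_compact T ->
  (forall q, open [set p | W p q]) -> (forall p, scott_open (W p)) ->
  W p0 q0 ->
  exists U V, [/\ open U, scott_open V, U p0, V q0 &
    forall p q, U p -> V q -> W p q].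
Proof.
move=> ccT oWl oWr Wpq.
have leW q q' : q <= q' -> [set p | W p q] `<=` [set p | W p q'].
  by move=> qq' p; exact: (scott_open_upper (oWr p) qq').
have [U [oU Up0 UW]] := (core_compactP.1 ccT) _ _ (oWl q0) Wpq.
exists U, [set q | compactly_in U [set p | W p q]]; split=> //; last first.
  by move=> p q Up /(compactly_in_subset (oWl q)); exact.
apply/scott_openE; split=> [q q' qq'|D q dD Dq UWq].
  by apply: compactly_inS => //; exact: leW.
have [Z [oZ UZ ZW]] := compactly_in_interpolate ccT (oWl q) UWq.
have [|||_ [q' Dq' <-] ZWq'] := ZW [set [set p | W p q'] | q' in D].
- by move=> _ [q' _ <-].
- split=> [|_ _ [a Da <-] [b Db <-]].
    by have [q' Dq'] := dD.1; exists [set p | W p q']; exists q'.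
  have [c [Dc ac bc]] := dD.2 a b Da Db.
  exists [set p | W p c]; rewrite !subsetEset.
  by split; [exists c|exact: leW|exact: leW].
- move=> p Wpq'; have [q' Dq' Wq'] := scott_open_sup (oWr p) dD Dq Wpq'.
  by exists [set p | W p q'] => //; exists q'.
by exists q' => //; exact: compactly_inS UZ.
Qed.

End Box.

(** * The lattice of Scott closed sets *)

Section Hyperspace.
Context {d : Order.disp_t} {P : porderType d}.
Implicit Types (x y : P) (A B C : Gamma P) (U V W : set P)
  (UU : set (Gamma P)).

Lemma Gamma_closed A : scott_closed (val A).
Proof. exact: (set_mem (valP A)). Qed.

Definition to_Gamma (X : set P) (cX : scott_closed X) : Gamma P :=
  exist (fun Y => Y \in [set Z : set P | scott_closed Z]) X (mem_set cX).

Lemma le_Gamma A B : (A <= B) = (val A `<=` val B) :> Prop.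
Proof. by rewrite -subsetEset. Qed.

Definition principal x : Gamma P := to_Gamma (scott_closed_principal x).

Definition joinG A B : Gamma P :=
  to_Gamma (scott_closedU (Gamma_closed A) (Gamma_closed B)).

Definition down_seq (xs : seq P) : Gamma P :=
  foldr (fun x => joinG (principal x)) (to_Gamma scott_closed0) xs.

Lemma principal_le x A : (principal x <= A) = val A x :> Prop.
Proof.
rewrite le_Gamma propeqE; split=> [|Ax y /= yx]; first by apply; exact: lexx.
by have [lA _] := Gamma_closed A; exact: (lA y x yx Ax).
Qed.

Lemma joinG_le A B C : (joinG A B <= C) = (A <= C /\ B <= C) :> Prop.
Proof. by rewrite !le_Gamma -subUset. Qed.

Lemma down_seqP xs y : val (down_seq xs) y <-> exists2 x, x \in xs & y <= x.
Proof.
elim: xs => [|x xs IH] /=; first by split=> // -[].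
split=> [[yx|/IH[z zxs yz]]|[z]].
- by exists x => //; rewrite mem_head.
- by exists z => //; rewrite inE zxs orbT.
- by rewrite inE => /predU1P[->|zxs yz]; [left|right; apply/IH; exists z].
Qed.

Lemma principal_homo : {homo principal : x y / x <= y}.
Proof. by move=> x y xy; rewrite principal_le. Qed.

(** A closed set that contains a directed D contains its supremum, so the
    principal ideals of the members of D have no smaller upper bound. *)
Lemma principal_sup (D : set P) s : directed D ->
  supremums D s -> supremums (principal @` D) (principal s).
Proof.
move=> dD Ds; split=> [_ [x Dx <-]|A DA]; rewrite principal_le; first exact: Ds.1.
have [_ supA] := Gamma_closed A; apply: (supA D dD _ s Ds) => x Dx.
by rewrite -principal_le; apply: DA; exists x.
Qed.

Lemma joinG_homor A : {homo joinG A : B C / B <= C}.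
Proof.
move=> B C BC; rewrite joinG_le; split; first by rewrite le_Gamma; exact: subsetUl.
by apply: le_trans BC _; rewrite le_Gamma; exact: subsetUr.
Qed.

Lemma joinG_homol B : {homo joinG^~ B : A C / A <= C}.
Proof.
move=> A C AC; rewrite joinG_le; split; last by rewrite le_Gamma; exact: subsetUr.
by apply: le_trans AC _; rewrite le_Gamma; exact: subsetUl.
Qed.

Lemma joinG_supr A (D : set (Gamma P)) B : directed D ->
  supremums D B -> supremums (joinG A @` D) (joinG A B).
Proof.
move=> [[C DC] _] [DB leB]; split=> [_ [E DE <-]|E DE].
  by apply: joinG_homor; exact: DB.
have jE F : D F -> A <= E /\ F <= E.
  by move=> DF; rewrite -joinG_le; apply: DE; exists F.
rewrite joinG_le; split; first exact: (jE C DC).1.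
by apply: leB => F /jE[].
Qed.

Lemma joinG_supl B (D : set (Gamma P)) A : directed D ->
  supremums D A -> supremums (joinG^~ B @` D) (joinG A B).
Proof.
move=> [[C DC] _] [DA leA]; split=> [_ [E DE <-]|E DE].
  by apply: joinG_homol; exact: DA.
have jE F : D F -> F <= E /\ B <= E.
  by move=> DF; rewrite -joinG_le; apply: DE; exists F.
rewrite joinG_le; split; last exact: (jE C DC).2.
by apply: leA => F /jE[].
Qed.

Lemma directed_principal (D : set P) : directed D -> directed (principal @` D).
Proof.
move=> [[x Dx] dD]; split=> [|_ _ [a Da <-] [b Db <-]].
  by exists (principal x); exists x.
have [c [Dc ac bc]] := dD a b Da Db.
by exists (principal c); split; [exists c|exact: principal_homo..].
Qed.

Lemma scott_open_joinG_principal UU B : scott_open UU ->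
  scott_open [set p | UU (joinG (principal p) B)].
Proof.
move=> oUU.
apply: (scott_open_preimage (f := fun p => joinG (principal p) B)) => //.
  by move=> x y xy; apply: joinG_homol; exact: principal_homo.
move=> D s dD Ds; rewrite -(image_comp principal (joinG^~ B)).
exact: joinG_supl (directed_principal dD) (principal_sup dD Ds).
Qed.

Lemma scott_open_joinGr UU A : scott_open UU -> scott_open (UU \o joinG A).
Proof.
apply: scott_open_preimage; first exact: joinG_homor.
exact: joinG_supr.
Qed.

Lemma scott_open_principal UU : scott_open UU -> scott_open (UU \o principal).
Proof.
by apply: scott_open_preimage; [exact: principal_homo|exact: principal_sup].
Qed.

Lemma not_diamondC U A (oU : scott_open U) :
  (A <= to_Gamma (oU : scott_closed (~` U))) = (~ diamond U A) :> Prop.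
Proof.
rewrite le_Gamma propeqE; split=> [AU [x [Ax Ux]]|nUA x Ax Ux].
  exact: (AU x).
by apply: nUA; exists x.
Qed.

(** The complement of diamond U is the principal ideal generated by the closed
    set complementary to U. *)
Lemma scott_open_diamond U : scott_open U -> scott_open (@diamond d P U).
Proof.
move=> oU.
have E A : (~` diamond U) A = (A <= to_Gamma (oU : scott_closed (~` U))) :> Prop.
  by rewrite not_diamondC.
split=> [A B AB|D _ DU A [_ leA]]; rewrite !E; first exact: le_trans.
by apply: leA => B /DU; rewrite E.
Qed.

Lemma diamond_bigcup (D : set (set P)) :
  @diamond d P (\bigcup_(U in D) U) = \bigcup_(U in D) diamond U.
Proof.
rewrite eqEsubset; split=> [A [x [Ax [U DU Ux]]]|A [U DU [x [Ax Ux]]]].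
  by exists U => //; exists x.
by exists x; split=> //; exists U.
Qed.

Lemma diamondS U V : U `<=` V -> @diamond d P U `<=` diamond V.
Proof. by move=> UV A [x [Ax /UV Vx]]; exists x. Qed.

Lemma diamond_principal U x : scott_open U -> diamond U (principal x) <-> U x.
Proof.
move=> oU; split=> [[y [yx Uy]]|Ux]; first exact: (scott_open_upper oU yx).
by exists x; split=> //=.
Qed.

(** The open sets of P are a retract of those of the hyperspace, by diamond and
    the preimage under [principal].  Given x in U, choose VV << diamond U
    containing [principal x]: a directed cover D of U yields the directed cover
    of diamond U by the diamonds of D, and the one that contains VV gives the
    member of D that contains the preimage of VV. *)
Lemma Gamma_core_compact_inv :
  core_compact (scott (Gamma P)) -> core_compact (scott P).
Proof.
move=> /core_compactP ccG; apply/core_compactP => U x oU Ux.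
have [|VV [oVV VVx VVU]] := ccG (diamond U) (principal x) (scott_open_diamond oU).
  exact/(diamond_principal _ oU).
exists (VV \o principal); split=> //; first exact: scott_open_principal.
move=> D oD dD UD; have [|||_ [O DO <-] VVO] := VVU (@diamond d P @` D).
- by move=> _ [O DO <-]; exact: scott_open_diamond (oD O DO).
- split=> [|_ _ [O DO <-] [Q DQ <-]].
    by have [O DO] := dD.1; exists (diamond O); exists O.
  have [R [DR OR QR]] := dD.2 O Q DO DQ; rewrite !subsetEset in OR QR.
  exists (diamond R); rewrite !subsetEset.
  by split; [exists R|exact: diamondS|exact: diamondS].
- rewrite bigcup_image -diamond_bigcup; exact: diamondS.
by exists O => // y /VVO /(diamond_principal _ (oD O DO)).
Qed.

(** * The Scott topology of the hyperspace is the lower Vietoris topology *)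

Definition diamonds (Us : seq (set P)) : set (Gamma P) :=
  [set A | forall U, U \in Us -> diamond U A].

Lemma diamonds_nil : diamonds [::] = setT.
Proof. by rewrite eqEsubset. Qed.

Lemma diamonds_cons U Us A :
  diamonds (U :: Us) A <-> diamond U A /\ diamonds Us A.
Proof.
split=> [h|[UA UsA] V]; last by rewrite inE => /predU1P[->|/UsA].
by split=> [|V VUs]; apply: h; rewrite inE ?eqxx ?VUs ?orbT.
Qed.

Lemma diamonds_consE U Us : diamonds (U :: Us) = diamond U `&` diamonds Us.
Proof. by apply/seteqP; split=> A /diamonds_cons. Qed.

Lemma diamond_le U A B : A <= B -> diamond U A -> diamond U B.
Proof. by rewrite le_Gamma => AB [x [/AB Bx Ux]]; exists x. Qed.

Lemma scott_open_diamonds Us :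
  (forall U, U \in Us -> scott_open U) -> scott_open (diamonds Us).
Proof.
elim: Us => [_|U Us IH oUs]; first by rewrite diamonds_nil; exact: scott_openT.
rewrite diamonds_consE; apply: scott_openI.
  by apply: scott_open_diamond; apply: oUs; rewrite mem_head.
by apply: IH => V VUs; apply: oUs; rewrite inE VUs orbT.
Qed.

(** The finitely generated lower subsets of A form a directed family with
    supremum A. *)
Lemma scott_open_down_seq UU A : scott_open UU -> UU A ->
  exists2 xs, (forall x, x \in xs -> val A x) & UU (down_seq xs).
Proof.
move=> oUU UUA.
pose D := [set down_seq xs | xs in [set xs | forall x, x \in xs -> val A x]].
have le_down xs ys : {subset xs <= ys} -> down_seq xs <= down_seq ys.
  move=> sub; rewrite le_Gamma => y /down_seqP[x /sub xys yx].
  by apply/down_seqP; exists x.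
have [||_ [xs xsA <-] UUxs] := scott_open_sup (D := D) oUU _ _ UUA.
- split=> [|_ _ [xs xsA <-] [ys ysA <-]]; first by exists (down_seq [::]); exists [::].
  exists (down_seq (xs ++ ys)); split.
  + by exists (xs ++ ys) => // x; rewrite mem_cat => /orP[/xsA|/ysA].
  + by apply: le_down => x; rewrite mem_cat => ->.
  + by apply: le_down => x; rewrite mem_cat orbC => ->.
- split=> [_ [xs xsA <-]|B DB].
    rewrite le_Gamma => y /down_seqP[x /xsA Ax yx].
    exact: (Gamma_closed A).1 yx Ax.
  rewrite le_Gamma => x Ax.
  have : down_seq [:: x] <= B.
    by apply: DB; exists [:: x] => // y; rewrite inE => /eqP->.
  by rewrite le_Gamma; apply; apply/down_seqP; exists x; rewrite ?mem_head.
by exists xs.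
Qed.

(** Adding one generator x: [separately_open_box] replaces the condition on x
    and the remaining generators by an open U around x and a Scott open VV
    around the set they generate, to which the induction applies.  A closed B
    in VV that contains a point p of U equals its join with [principal p], and
    so belongs to UU. *)
Lemma down_seq_diamonds UU xs : core_compact (scott P) -> scott_open UU ->
  UU (down_seq xs) ->
  exists Us, [/\ forall U, U \in Us -> scott_open U,
    diamonds Us (down_seq xs) & diamonds Us `<=` UU].
Proof.
move=> ccP; elim: xs UU => [|x xs IH] UU oUU /= UUxs.
  exists [::]; split=> // A _; apply: (scott_open_upper oUU _ UUxs).
  by rewrite le_Gamma.
have [U [VV [oU oVV Ux VVxs UVV]]] :=
  separately_open_box (T := scott P) (W := fun p B => UU (joinG (principal p) B))
    ccP (fun B => scott_open_joinG_principal B oUU)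
    (fun p => scott_open_joinGr (principal p) oUU) UUxs.
have [Us [oUs Usxs UsVV]] := IH VV oVV VVxs.
exists (U :: Us); split=> [V|V|B /diamonds_cons[[p [Bp Up]] /UsVV VVB]].
- by rewrite inE => /predU1P[->|/oUs].
- rewrite inE => /predU1P[->|/Usxs].
    by exists x; split=> //; left; exact: lexx.
  by apply: diamond_le; rewrite le_Gamma; exact: subsetUr.
apply: (scott_open_upper oUU _ (UVV p B Up VVB)).
by rewrite joinG_le principal_le; split.
Qed.

Lemma scott_open_diamonds_base UU A : core_compact (scott P) ->
  scott_open UU -> UU A ->
  exists Us, [/\ forall U, U \in Us -> scott_open U,
    diamonds Us A & diamonds Us `<=` UU].
Proof.
move=> ccP oUU UUA; have [xs xsA UUxs] := scott_open_down_seq oUU UUA.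
have [Us [oUs Usxs UsUU]] := down_seq_diamonds ccP oUU UUxs.
exists Us; split=> // U /Usxs; apply: diamond_le.
rewrite le_Gamma => y /down_seqP[x /xsA Ax yx].
exact: (Gamma_closed A).1 yx Ax.
Qed.

Lemma open_vietoris_diamond U : scott_open U ->
  open (diamond U : set (lower_vietoris P)).
Proof.
move=> oU.
exists [set (diamond U : set (lower_vietoris P))]; last by rewrite bigcup_set1.
by move=> _ ->; exact: (@finI_from1 _ _ (open_sets (scott P)) (@diamond d P)).
Qed.

Lemma open_vietoris_diamonds Us : (forall U, U \in Us -> scott_open U) ->
  open (diamonds Us : set (lower_vietoris P)).
Proof.
elim: Us => [_|U Us IH oUs]; first by rewrite diamonds_nil; exact: openT.
rewrite diamonds_consE; apply: openI.
  by apply: open_vietoris_diamond; apply: oUs; rewrite mem_head.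
by apply: IH => V VUs; apply: oUs; rewrite inE VUs orbT.
Qed.

Lemma open_vietoris_scott UU :
  open (UU : set (lower_vietoris P)) -> scott_open UU.
Proof.
move=> [D DfinI <-].
rewrite -[scott_open _]/(open (_ : set (scott (Gamma P)))).
apply: bigcup_open => VV /DfinI[E EP <-].
apply: (@scott_open_diamonds (enum_fset (E : {fset set P}))) => U /EP.
by rewrite inE.
Qed.

Lemma scott_Gamma_vietoris : core_compact (scott P) ->
  open_sets (scott (Gamma P)) = open_sets (lower_vietoris P).
Proof.
move=> ccP; rewrite eqEsubset; split=> UU; last exact: open_vietoris_scott.
move=> oUU; rewrite /open_sets openE => A UUA.
have [Us [oUs UsA UsUU]] := scott_open_diamonds_base ccP oUU UUA.
rewrite /interior nbhsE; exists (diamonds Us) => //; split=> //.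
exact: open_vietoris_diamonds.
Qed.

(** * Sobriety and local compactness of the hyperspace *)

(** The generic point of an irreducible closed family C is the closure S of its
    union.  An open set that meets S meets some member of C; by irreducibility
    a single member of C then lies in any given basic neighbourhood of S, and
    S belongs to C since C is closed. *)
Lemma scott_Gamma_sober : core_compact (scott P) -> sober (scott (Gamma P)).
Proof.
move=> ccP C [clC [C0 C0C] irrC].
have clC' : scott_closed (C : set (Gamma P)) by move: clC; rewrite closed_scottE.
have oC : scott_open (~` C : set (Gamma P)) by rewrite /scott_open setCK.
have irr_diamonds Us : (forall U, U \in Us -> scott_open U) ->
    (forall U, U \in Us -> exists2 B, C B & diamond U B) ->
    exists2 B, C B & diamonds Us B.
  elim: Us => [_ _|U Us IH oUs CUs]; first by exists C0.
  have [|V VUs|B CB UsB] := IH.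
  - by move=> V VUs; apply: oUs; rewrite inE VUs orbT.
  - by apply: CUs; rewrite inE VUs orbT.
  have [D CD UD] := CUs U (mem_head U Us).
  apply: contrapT => nUUs.
  case: (irrC (~` diamond U) (~` diamonds Us)).
  - by apply: open_closedC; apply: scott_open_diamond; apply: oUs; rewrite mem_head.
  - apply: open_closedC; apply: scott_open_diamonds => V VUs.
    by apply: oUs; rewrite inE VUs orbT.
  - move=> E CE; rewrite -setCI => -[UE UsE]; apply: nUUs.
    by exists E => //; apply/diamonds_cons.
  - by move=> /(_ D CD).
  - by move=> /(_ B CB).
pose X : set (scott P) := \bigcup_(B in C) val B.
have clX : scott_closed (closure X : set P).
  by rewrite -closed_scottE; exact: closed_closure.
pose S := to_Gamma clX.
have CS : C S.
  apply: contrapT => nCS.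
  have [Us [oUs UsS UsC]] := scott_open_diamonds_base ccP oC nCS.
  have [//|U UUs|B CB /UsC] := irr_diamonds Us; last by [].
  have [x [Sx Ux]] := UsS U UUs.
  have [|y [[B CB By] Uy]] := Sx U.
    by apply: open_nbhs_nbhs; split=> //; exact: oUs.
  by exists B => //; exists y.
have CE : C = closure [set (S : scott (Gamma P))].
  rewrite scott_closure1 eqEsubset; split=> [B CB|B BS].
    rewrite /= le_Gamma => x Bx; apply: subset_closure; by exists B.
  exact: clC'.1 BS CS.
exists S; split=> // S' C'E; apply/le_anti.
move: CS (CE); rewrite {1}C'E scott_closure1 => /= SS' CE'.
rewrite SS' /=.
have : C S' by rewrite C'E scott_closure1 /=.
by rewrite CE' scott_closure1.
Qed.

(** For an ultrafilter F on the family, let D be the directed set of the open O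
    with diamond O not in F, and C the complement of its union.  If C missed
    some W in FF, then D would cover W; for V << W in FF some O in D would
    contain V, and diamond O, which contains the whole family, would be in F.
    So C is in the family.  By choice of D, each diamond containing C is in F,
    that is, F converges to C. *)
Lemma compact_diamonds (FF : set (set P)) : core_compact (scott P) ->
  (forall W, FF W -> exists2 V, FF V & compactly_in (V : set (scott P)) W) ->
  compact ([set A | forall W, FF W -> diamond W A] : set (scott (Gamma P))).
Proof.
move=> ccP FFw; rewrite compact_ultra => F uF FK.
pose D : set (set P) := [set O | scott_open O /\ ~ F (diamond O)].
have DE : D `<=` @open (scott P) by move=> O [].
have dD : directed D.
  apply: directed_setU_closed.
    split; first exact: (@open0 (scott P)).
    move=> /filter_ex[A [x [_ []]]].
  move=> O Q [oO nFO] [oQ nFQ]; split; first exact: (@openU (scott P)).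
  move=> FOQ; have [//|FnO] := in_ultra_setVsetC (diamond O) uF.
  (* A closed set that meets the union of O and Q but not O must meet Q. *)
  apply: nFQ; apply: filterS (filterI FOQ FnO) => A [[x [Ax [Ox|Qx]]] nOA].
    by case: nOA; exists x.
  by exists x.
pose C := ~` \bigcup_(O in D) O.
have cC : scott_closed C.
  by apply: (bigcup_open (T := scott P)) => O [].
exists (to_Gamma cC); split=> [W FFW|UU].
  apply: contrapT => nW.
  have [V FFV VW] := FFw W FFW.
  have [//|//||O [oO nFO] VO] := VW D.
    by move=> x Wx; apply: contrapT => nDx; apply: nW; exists x.
  by apply: nFO; apply: filterS FK => A /(_ V FFV); exact: diamondS.
rewrite nbhsE => -[VV [oVV VVC] VVUU].
have [Us [oUs UsC UsVV]] := scott_open_diamonds_base ccP oVV VVC.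
apply: filterS VVUU _; apply: filterS UsVV _.
elim: Us oUs UsC => [|U Us IH] oUs UsC.
  by apply: filterS filterT => A _.
have /diamonds_cons[UC UsC'] := UsC.
have FU : F (diamond U).
  apply: contrapT => nFU; have [x [Cx Ux]] := UC.
  by apply: Cx; exists U => //; split=> //; apply: oUs; rewrite mem_head.
have FUs : F (diamonds Us).
  by apply: IH => // V VUs; apply: oUs; rewrite inE VUs orbT.
by apply: filterS (filterI FU FUs) => A [UA UsA]; apply/diamonds_cons.
Qed.

(** Shrink each Ui of a basic neighbourhood of A to an open Vi << Ui that still
    meets A.  The closed sets meeting every W that is way above some Vi form a
    compact family between the two basic neighbourhoods: each Ui is such a W,
    and every such W contains the corresponding Vi. *)
Lemma scott_Gamma_locally_compact :
  core_compact (scott P) -> locally_compact_space (scott (Gamma P)).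
Proof.
move=> ccP A UU oUU UUA.
have [Us [oUs UsA UsUU]] := scott_open_diamonds_base ccP oUU UUA.
have /choice[f fP] : forall U, exists V, U \in Us ->
    [/\ scott_open V, diamond V A & compactly_in (V : set (scott P)) U].
  move=> U; have [UUs|] := boolP (U \in Us); last by exists U.
  have [x [Ax Ux]] := UsA U UUs.
  have [V [oV Vx VU]] := (core_compactP.1 ccP) U x (oUs U UUs) Ux.
  by exists V => _; split=> //; exists x.
pose FF : set (set P) := [set W | scott_open W /\
  exists2 U, U \in Us & compactly_in (f U : set (scott P)) W].
exists [set B | forall W, FF W -> diamond W B]; split.
- apply: compact_diamonds => // W [oW [U UUs fW]].
  have [V [oV fV VW]] := compactly_in_interpolate ccP oW fW.
  by exists V => //; split=> //; exists U.
- rewrite /interior nbhsE; exists (diamonds [seq f U | U <- Us]).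
    split; last by move=> _ /mapP[U /fP[_ UA _] ->].
    by apply: scott_open_diamonds => _ /mapP[U /fP[oU _ _] ->].
  move=> B fB W [oW [U UUs fW]].
  have fUW : (f U : set P) `<=` W := compactly_in_subset (T := scott P) oW fW.
  by apply: (diamondS fUW); apply: fB; exact: map_f.
- move=> B FFB; apply: UsUU => U UUs; apply: FFB; split; first exact: oUs.
  by exists U => //; have [] := fP U UUs.
Qed.

End Hyperspace.

Theorem theorem3p13 (d : Order.disp_t) (P : porderType d) :
  [<-> core_compact (scott P);
       core_compact (scott (Gamma P));
       sober (scott (Gamma P)) /\ locally_compact_space (scott (Gamma P));
       [/\ sober (scott (Gamma P)),
           locally_compact_space (scott (Gamma P)) &
           open_sets (scott (Gamma P)) = open_sets (lower_vietoris P)]].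
Proof.
have lc_cc : locally_compact_space (scott (Gamma P)) -> core_compact (scott P).
  by move=> /locally_compact_core_compact/Gamma_core_compact_inv.
tfae.
- by move=> /scott_Gamma_locally_compact/locally_compact_core_compact.
- move=> /Gamma_core_compact_inv ccP.
  by split; [exact: scott_Gamma_sober|exact: scott_Gamma_locally_compact].
- by move=> [sG lcG]; split=> //; apply: scott_Gamma_vietoris; exact: lc_cc.
- by move=> [_ lcG _]; exact: lc_cc.
Qed.
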